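(* Let $\mathcal M$ be a semifinite von Neumann algebra with a normal semifinite faithful trace $tr$, and let $a\in\overline{\mathcal M}$ be a $tr$-measurable operator such that $\mathrm{ord}_0(a)=1$. Then $a$ is $0$-eccentric.
   Context: $\mathcal M\subset\mathcal B(\mathcal H)$ is a semifinite von Neumann algebra with a normal semifinite faithful trace $tr$. $\overline{\mathcal M}$ denotes the $tr$-measurable operators, i.e. the closed, densely defined operators $x$ on $\mathcal H$ affiliated with $\mathcal M$ such that $tr(e_{|x|}(t,\infty))<\infty$ for some $t>0$, where $e_{|x|}$ is the spectral measure of $|x|$. For $a\in\overline{\mathcal M}$ and $t>0$: $\lambda_a(t):=tr(e_{|a|}(t,\infty))$ is the distribution function and $\mu_a(t):=\inf\{s\ge 0:\lambda_a(s)\le t\}$ is the non-increasing rearrangement of $a$. The order of infinite of $a$ at $0$ is $\mathrm{ord}_0(a):=\liminf_{t\to0^+}\frac{\log\mu_a(t)}{\log(1/t)}$. Set $S^0_a(t):=\int_0^t\mu_a(s)\,ds$ if $\mu_a\in L^1(0,1)$, and $S^0_a(t):=\int_t^1\mu_a(s)\,ds$ if $\mu_a\notin L^1(0,1)$. The operator $a$ is called $0$-eccentric if $1$ is a limit point of $\left\{\frac{S^0_a(2t)}{S^0_a(t)}\right\}$ when $t\to0^+$, i.e. there is a sequence $t_j\to0^+$ with $S^0_a(2t_j)/S^0_a(t_j)\to1$. *)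

(* Defs.v *)
From HB Require Import structures.
From mathcomp Require Import all_boot all_order all_algebra.
From mathcomp Require Import all_classical all_reals all_analysis.
From mathcomp Require Import complex.
Set Implicit Arguments.
Unset Strict Implicit.
Unset Printing Implicit Defensive.
Import Order.TTheory GRing.Theory Num.Theory.
Import numFieldNormedType.Exports.
Local Open Scope classical_set_scope.
Local Open Scope complex_scope.
Local Open Scope ring_scope.

Section Operators.
Context {R : realType} {H : completeNormedModType R[i]}.
(* linear in the first argument, conjugate-linear in the second *)
Variable dot : {dot H for Num.conj}.

(* [dot] turns the Banach space H into a complex Hilbert space *)
Definition is_hilbert := forall x : H, `|x| ^+ 2 = dot x x.

Definition bounded_operator (T : H -> H) :=
  linear T /\ exists c : R[i], forall x, `|T x| <= c * `|x|.

(* S is the adjoint of T, for everywhere defined operators *)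
Definition is_adjoint (T S : H -> H) := forall x y, dot (T x) y = dot x (S y).

Definition commutant (M : set (H -> H)) : set (H -> H) :=
  [set T | bounded_operator T /\ forall S, M S -> T \o S = S \o T].

(* von Neumann algebra: a self-adjoint set of bounded operators equal to its
   bicommutant (a commutant is automatically a unital subalgebra). *)
Record von_neumann_algebra (M : set (H -> H)) : Prop := {
  vna_bounded : M `<=` bounded_operator ;
  vna_star : forall T S, M T -> bounded_operator S -> is_adjoint T S -> M S ;
  vna_bicommutant : commutant (commutant M) = M }.

(* Order of R[i]: [0 <= z] means that z is real and nonnegative; [z <= w] means
   that [w - z] is. *)
Definition op_le (S T : H -> H) := forall x, dot (S x) x <= dot (T x) x.

Definition positive_part (M : set (H -> H)) : set (H -> H) :=
  [set T | M T /\ op_le (fun=> 0) T].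

Definition directed (D : set (H -> H)) :=
  D !=set0 /\
  forall S T, D S -> D T -> exists2 U, D U & op_le S U /\ op_le T U.

Definition is_op_sup (M D : set (H -> H)) (S : H -> H) :=
  [/\ positive_part M S, forall T, D T -> op_le T S &
      forall U, positive_part M U -> (forall T, D T -> op_le T U) ->
        op_le S U].

(* Only the values of [tr] on the positive part of M are relevant. The range of
   an increasing net is a directed set, so normality is stated with those. *)
Record nsf_trace (M : set (H -> H)) (tr : (H -> H) -> \bar R) : Prop := {
  tr_ge0 : forall T, positive_part M T -> (0 <= tr T)%E ;
  tr_add : forall S T, positive_part M S -> positive_part M T ->
    tr (S \+ T) = (tr S + tr T)%E ;
  tr_scale : forall (r : R) T, 0 <= r -> positive_part M T ->
    tr (fun x => r%:C *: T x) = (r%:E * tr T)%E ;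
  tr_comm : forall T S, M T -> M S -> is_adjoint T S ->
    tr (S \o T) = tr (T \o S) ;
  tr_normal : forall D S, D `<=` positive_part M -> directed D ->
    is_op_sup M D S -> tr S = ereal_sup (tr @` D) ;
  tr_semifinite : forall T, positive_part M T -> T <> (fun=> 0) ->
    exists S, [/\ positive_part M S, S <> (fun=> 0), op_le S T &
                  (tr S < +oo)%E] ;
  tr_faithful : forall T, positive_part M T -> tr T = 0%E -> T = (fun=> 0) }.

(* An unbounded operator x is represented by its graph, the set of the pairs
   (u, x u) for u in the domain of x. *)
Definition domain (G : set (H * H)) : set H := fst @` G.

Record is_operator (G : set (H * H)) : Prop := {
  graph0 : G 0 ;
  graph_linear : forall (c : R[i]) p q, G p -> G q -> G (c *: p + q) ;
  graph_fun : forall u v w, G (u, v) -> G (u, w) -> v = w }.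

Definition densely_defined_closed (G : set (H * H)) :=
  [/\ is_operator G, closed G & dense (domain G)].

Definition graph_adjoint (G : set (H * H)) : set (H * H) :=
  [set p | forall q, G q -> dot q.2 p.1 = dot q.1 p.2].

Definition graph_comp (G F : set (H * H)) : set (H * H) :=
  [set p | exists2 v, F (p.1, v) & G (v, p.2)].

Definition positive_selfadjoint (G : set (H * H)) :=
  [/\ is_operator G, dense (domain G), graph_adjoint G = G &
      forall p, G p -> 0 <= dot p.2 p.1].

Definition unitary (U : H -> H) :=
  exists V, [/\ bounded_operator U, bounded_operator V, is_adjoint U V,
                U \o V = id & V \o U = id].

(* U x U^* = x for every unitary U of the commutant of M: the graph of
   U x U^* is the image of that of x under U x U. *)
Definition affiliated (M : set (H -> H)) (G : set (H * H)) :=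
  forall U, commutant M U -> unitary U ->
    (fun p => (U p.1, U p.2)) @` G = G.

(* |x|, the unique positive self-adjoint square root of x^* x *)
Definition abs_operator (G : set (H * H)) : set (H * H) :=
  get [set T | positive_selfadjoint T /\
               graph_comp T T = graph_comp (graph_adjoint G) G].

Record projection_valued_measure (e : set R -> H -> H) : Prop := {
  pvm_projection : forall B, measurable B ->
    [/\ bounded_operator (e B), is_adjoint (e B) (e B) &
        e B \o e B = e B] ;
  pvm_total : e setT = id ;
  pvm_sigma_additive : forall B : (set R)^nat,
    (forall n, measurable (B n)) -> trivIset setT B ->
    forall u, series (fun n => e (B n) u) @ \oo --> e (\bigcup_n B n) u }.

(* B |-> <e(B) u, u> *)
Definition quadratic_measure (e : set R -> H -> H) (u : H) : set R -> \bar R :=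
  fun B => (complex.Re (dot (e B u) u))%:E.

(* e is the spectral measure of the self-adjoint operator T *)
Record is_spectral_measure (T : set (H * H)) (e : set R -> H -> H) : Prop := {
  spectral_pvm : projection_valued_measure e ;
  spectral_domain : domain T =
    [set u | (\int[quadratic_measure e u]_s (s ^+ 2)%:E < +oo)%E] ;
  spectral_form : forall u v, T (u, v) ->
    dot v u = (fine (\int[quadratic_measure e u]_s s%:E)%E)%:C }.

(* unique on Borel sets, its only relevant arguments *)
Definition spectral_measure (T : set (H * H)) : set R -> H -> H :=
  get (is_spectral_measure T).

Definition distribution_function (tr : (H -> H) -> \bar R) (G : set (H * H))
    (t : R) : \bar R :=
  tr (spectral_measure (abs_operator G) `]t, +oo[).

Record tr_measurable (M : set (H -> H)) (tr : (H -> H) -> \bar R)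
    (G : set (H * H)) : Prop := {
  trm_closed : densely_defined_closed G ;
  trm_affiliated : affiliated M G ;
  trm_finite : exists2 t : R, 0 < t & (distribution_function tr G t < +oo)%E }.

Definition rearrangement (tr : (H -> H) -> \bar R) (G : set (H * H))
    (t : R) : \bar R :=
  ereal_inf
    [set s%:E | s in [set s | 0 <= s /\
                              (distribution_function tr G s <= t%:E)%E]].

Definition order_infinite0 (tr : (H -> H) -> \bar R) (G : set (H * H)) : \bar R :=
  limf_einf (fun t => lne (rearrangement tr G t) / (ln (1 / t))%:E)%E 0^'+.

Definition S0 (tr : (H -> H) -> \bar R) (G : set (H * H)) (t : R) : \bar R :=
  if `[< lebesgue_measure.-integrable `]0%R, 1%R[%classic (rearrangement tr G) >]
  then (\int[lebesgue_measure]_(s in `]0%R, t[%classic) rearrangement tr G s)%E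
  else (\int[lebesgue_measure]_(s in `]t, 1%R[%classic) rearrangement tr G s)%E.

Definition eccentric0 (tr : (H -> H) -> \bar R) (G : set (H * H)) :=
  exists t : R^nat, [/\ forall j, 0 < t j, t @ \oo --> 0 &
    (fun j => S0 tr G (2 * t j) / S0 tr G (t j))%E @ \oo --> 1%E].

End Operators.

(* Main.v *)
Require Import Defs.
From HB Require Import structures.
From mathcomp Require Import all_boot all_order all_algebra.
From mathcomp Require Import all_classical all_reals all_analysis.
From mathcomp Require Import measurable_realfun complex.
From mathcomp Require Import lra.
Import Order.TTheory GRing.Theory Num.Theory.
Import numFieldNormedType.Exports.
Local Open Scope classical_set_scope.
Local Open Scope complex_scope.
Local Open Scope ring_scope.

(** Order 1 at 0 is the borderline of integrability of f = mu_a, where S^0_a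
    cannot follow a power law: an increasing one would make the order smaller
    than 1, a decreasing one would make it larger. If 1 is not a limit point of
    S(2t)/S(t), the monotonicity of S turns this into a gap e > 0 between
    S(2t)/S(t) and 1 for all small t, and iterating the gap along t, 2t, 4t, ...
    bounds S by such a power:

    - f integrable near 0: S(2t) >= (1+e) S(t) gives S(t) <= C t^a with
      2^a = 1+e. Since f is nonincreasing, t f(t) <= S(t), hence
      f(t) <= C t^(a-1) and liminf log f(t) / log (1/t) <= 1 - a < 1.
    - f not integrable near 0: S(2t) <= (1-e) S(t) gives S(t) >= C t^(-a), and
      t f(t) >= S(t) - S(2t) >= e S(t), hence f(t) >= e C t^(-1-a) and
      liminf log f(t) / log (1/t) >= 1 + a > 1.

    The two cases are [increasing_doubling] and [decreasing_doubling]; the order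
    of f contradicts the power bound through [order_gt] in the first and through
    [order_lt] in the second. That mu_a is finite and positive near 0,
    so that the quotients make sense, is also read off from its order, by
    [fin_num_of_order] and [gt0_of_order]. *)

(** * Dyadic iteration and doubling ratios *)

Section Doubling.
Context {R : realType}.
Implicit Types (S g P : R -> R) (c d e t : R).

Lemma near_right0P (P : set R) :
  (\forall t \near 0^'+, P t) <->
  exists2 d, 0 < d & forall t, 0 < t < d -> P t.
Proof.
split=> [|[d d0 Pd]]; last first.
  near=> t; apply: Pd; apply/andP; split; first by near: t; exact: nbhs_right_gt.
  by near: t; exact: nbhs_right_lt.
rewrite /at_right /within /= => /nbhs_ballP[d /= d0 dP]; exists d => // t.
move=> /andP[t0 td].
by apply: dP => //=; rewrite /ball/= sub0r normrN gtr0_norm.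
Unshelve. all: by end_near. Qed.

(** Doubling repeatedly brings any t in ]0, t0] into the top dyadic block
    ]t0 / 2, t0], and P only increases along the way. *)
Lemma dyadic_bound {P C t0} : 0 < t0 ->
  (forall t, 0 < t -> 2 * t <= t0 -> P t <= P (2 * t)) ->
  (forall t, t0 / 2 < t <= t0 -> P t <= C) ->
  forall t, 0 < t <= t0 -> P t <= C.
Proof.
move=> t0_gt0 Pdbl Ptop.
have H n : forall t, 0 < t <= t0 -> t0 / 2 < t * 2 ^+ n -> P t <= C.
  elim: n => [|n IHn] t /andP[t_gt0 tt0] tn.
    by apply: Ptop; rewrite tt0 andbT; rewrite expr0 mulr1 in tn.
  have [tt|tt] := leP (2 * t) t0.
    apply: le_trans (Pdbl _ t_gt0 tt) _; apply: IHn.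
      by rewrite tt andbT; lra.
    by rewrite exprS in tn; rewrite (mulrC 2) -mulrA.
  by apply: Ptop; rewrite tt0 andbT; lra.
move=> t /[dup] tt0 /andP[t_gt0 _].
apply: (H (Num.truncn (t0 / t)).+1 _ tt0).
have n1 : t0 / t < 2 ^+ (Num.truncn (t0 / t)).+1.
  have := truncnS_gt (t0 / t) => /lt_trans; apply.
  by rewrite -natrX ltr_nat ltn_expl.
have : t0 < t * 2 ^+ (Num.truncn (t0 / t)).+1.
  by rewrite mulrC -ltr_pdivrMr.
by apply: le_lt_trans; lra.
Qed.

(** A positive power of t beats any constant. *)
Lemma powR_lt_inv_near0 {c C} : 0 < c -> 0 < C ->
  exists2 d, 0 < d & forall t, 0 < t < d -> C * t `^ c < 1.
Proof.
move=> c0 C0; exists (C^-1 `^ c^-1); first by rewrite powR_gt0// invr_gt0.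
move=> t /andP[t0 td].
have : t `^ c < (C^-1 `^ c^-1) `^ c.
  by apply: gt0_ltr_powR; rewrite // nnegrE ?powR_ge0// ltW.
rewrite -powRrM mulVf ?gt_eqF// powRr1 ?invr_ge0 ?(ltW C0)// => h.
by rewrite mulrC -ltr_pdivlMr// div1r.
Qed.

(** The exponent a of the power law produced by a doubling gap e. *)
Lemma exists_powR2 {e} : 0 < e -> exists2 a, 0 < a & 2 `^ a = 1 + e.
Proof.
move=> e0; exists (ln (1 + e) / ln 2).
  by rewrite divr_gt0 ?ln_gt0 ?ltrDl// ltr1n.
have ln2 : 0 < ln (2 : R) by rewrite ln_gt0 ?ltr1n.
rewrite /powR gt_eqF// mulrVK ?unitf_gt0// lnK// posrE; lra.
Qed.

(** With a gap S (2t) >= (1+e) S t for small t, the function t |-> S t / t^a with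
    2^a = 1+e would not decrease under doubling, hence S t <= C t^a. Then g, which
    is at most S t / t, could not exceed t^(-(1 - a/2)) near 0. *)
Lemma increasing_doubling {S g d} : 0 < d ->
  (forall t, 0 < t < d -> 0 < S t) ->
  (forall s t, 0 < s -> s <= t -> t < d -> S s <= S t) ->
  (forall t, 0 < t < d -> t * g t <= S t) ->
  (forall c, c < 1 -> \forall t \near 0^'+, t `^ (- c) < g t) ->
  forall e, 0 < e -> exists2 t, 0 < t < e & `|S (2 * t) / S t - 1| < e.
Proof.
move=> d0 S0 Smono Sg gbig e e0; apply: contrapT => noe.
have [a a0 a2] := exists_powR2 e0.
pose t0 := Num.min d e / 2.
have t00 : 0 < t0 by rewrite divr_gt0// lt_min d0.
have t0d : t0 * 2 <= d by rewrite /t0 divfK// ge_min lexx.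
have t0e : t0 * 2 <= e by rewrite /t0 divfK// ge_min lexx orbT.
have Sgap t : 0 < t -> 2 * t <= t0 -> (1 + e) * S t <= S (2 * t).
  move=> t_gt0 tt0.
  have St : 0 < S t by apply: S0; apply/andP; split; lra.
  have S2 : S t <= S (2 * t) by apply: Smono; lra.
  rewrite -ler_pdivlMr// leNgt; apply/negP => lt1e; apply: noe.
  exists t; first by apply/andP; split; lra.
  have : 1 <= S (2 * t) / S t by rewrite ler_pdivlMr// mul1r.
  by move=> ?; rewrite ger0_norm; lra.
(* By monotonicity, C bounds S t * t^(-a) on the block ]t0 / 2, t0]. *)
pose C := S t0 * (t0 / 2) `^ (- a).
have C0 : 0 < C.
  rewrite /C; apply: mulr_gt0; last by apply: powR_gt0; lra.
  by apply: S0; apply/andP; split; lra.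
have SC : forall t, 0 < t <= t0 -> S t * t `^ (- a) <= C.
  apply: (@dyadic_bound (fun t => S t * t `^ (- a))) => // t.
    move=> t_gt0 tt0; rewrite powRM ?ler0n ?(ltW t_gt0)// [2 `^ _]powRN a2 mulrA.
    rewrite ler_wpM2r ?powR_ge0// ler_pdivlMr; last by lra.
    by rewrite mulrC; exact: Sgap.
  move=> /andP[t1 t2]; apply: ler_pM; rewrite ?powR_ge0//.
  - by apply/ltW/S0/andP; split; lra.
  - by apply: Smono; lra.
  - rewrite !powRN lef_pV2 ?posrE ?powR_gt0//; try lra.
    by apply: ge0_ler_powR; rewrite ?nnegrE; lra.
(* Half of the exponent a is given up to absorb the constant C. *)
have /near_right0P[d1 d10 gd1] :
    \forall t \near 0^'+, t `^ (- (1 - a / 2)) < g t.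
  by apply: gbig; lra.
have [d2 d20 Cd2] : exists2 d, 0 < d &
    forall t, 0 < t < d -> C * t `^ (a / 2) < 1.
  by apply: powR_lt_inv_near0 => //; lra.
pose t := Num.min t0 (Num.min d1 d2) / 2.
have t_gt0 : 0 < t by rewrite divr_gt0// !lt_min t00 d10.
have t20 : t * 2 <= t0 by rewrite /t divfK// ge_min lexx.
have t21 : t * 2 <= d1 by rewrite /t divfK// !ge_min lexx orbT.
have t22 : t * 2 <= d2 by rewrite /t divfK// !ge_min lexx !orbT.
have td : 0 < t < d by apply/andP; split; lra.
have td1 : 0 < t < d1 by apply/andP; split; lra.
have td2 : 0 < t < d2 by apply/andP; split; lra.
have tt0 : 0 < t <= t0 by apply/andP; split; lra.
have := SC _ tt0; have := Cd2 _ td2; have := gd1 _ td1; have := Sg _ td.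
have tN0 : t != 0 by rewrite gt_eqF.
have -> : - (1 - a / 2) = - 1 + a / 2 by lra.
have -> : - a = - (a / 2) + - (a / 2) by lra.
rewrite !powRD ?tN0 ?implybT// powR_inv1 ?(ltW t_gt0)// powRN.
have : 0 < t `^ (a / 2) by rewrite powR_gt0.
set p := t `^ (a / 2) => p0 H1 H2 H3.
have H4 : p < S t.
  by apply: lt_le_trans H1; rewrite mulrC -ltr_pdivrMr// mulrC.
rewrite -invfM ler_pdivrMr ?mulr_gt0// => H5.
have : C * (p * p) < 1 * p by rewrite mulrA ltr_pM2r.
lra.
Qed.

(** With a gap S (2t) <= (1-e) S t for small t, also (1+e) S (2t) <= S t, and
    t |-> S t * t^a with 2^a = 1+e would not increase under doubling, hence
    S t >= C t^(-a). Then g, which is at least (S t - S (2t)) / t >= e S t / t,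
    could not fall below t^(-(1 + a/2)) arbitrarily near 0. *)
Lemma decreasing_doubling {S g d} : 0 < d ->
  (forall t, 0 < t < d -> 0 < S t) ->
  (forall s t, 0 < s -> s <= t -> t < d -> S t <= S s) ->
  (forall t, 0 < t < d -> S t - S (2 * t) <= t * g t) ->
  (forall c d, 1 < c -> 0 < d -> exists2 t, 0 < t < d & g t < t `^ (- c)) ->
  forall e, 0 < e -> exists2 t, 0 < t < e & `|S (2 * t) / S t - 1| < e.
Proof.
move=> d0 S0 Smono Sg gsmall e e0; apply: contrapT => noe.
have [a a0 a2] := exists_powR2 e0.
pose t0 := Num.min d e / 2.
have t00 : 0 < t0 by rewrite divr_gt0// lt_min d0.
have t0d : t0 * 2 <= d by rewrite /t0 divfK// ge_min lexx.
have t0e : t0 * 2 <= e by rewrite /t0 divfK// ge_min lexx orbT.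
have Sgap t : 0 < t -> 2 * t <= t0 -> S (2 * t) <= (1 - e) * S t.
  move=> t_gt0 tt0.
  have St : 0 < S t by apply: S0; apply/andP; split; lra.
  have S2 : S (2 * t) <= S t by apply: Smono; lra.
  rewrite -ler_pdivrMr// leNgt; apply/negP => lt1e; apply: noe.
  exists t; first by apply/andP; split; lra.
  have : S (2 * t) / S t <= 1 by rewrite ler_pdivrMr// mul1r.
  by move=> ?; rewrite ler0_norm; lra.
(* By monotonicity, C is a lower bound of S t * t^a on ]t0 / 2, t0]. *)
pose C := S t0 * (t0 / 2) `^ a.
have C0 : 0 < C.
  rewrite /C; apply: mulr_gt0; last by apply: powR_gt0; lra.
  by apply: S0; apply/andP; split; lra.
have SC : forall t, 0 < t <= t0 -> - (S t * t `^ a) <= - C.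
  apply: (@dyadic_bound (fun t => - (S t * t `^ a))) => // t.
    move=> t_gt0 tt0; rewrite powRM ?ler0n ?(ltW t_gt0)// a2 mulrA lerN2.
    rewrite ler_wpM2r ?powR_ge0//.
    have St : 0 < S t by apply: S0; apply/andP; split; lra.
    (* (1 - e) (1 + e) <= 1 *)
    apply: (@le_trans _ _ ((1 - e) * S t * (1 + e))).
      by rewrite ler_wpM2r ?Sgap//; lra.
    have : 0 <= e * e * S t by rewrite !mulr_ge0 ?ltW.
    lra.
  move=> /andP[t1 t2]; rewrite lerN2; apply: ler_pM; rewrite ?powR_ge0//.
  - by apply/ltW/S0/andP; split; lra.
  - by apply: Smono; lra.
  - by apply: ge0_ler_powR; rewrite ?nnegrE; lra.
(* Half of the exponent a is given up to absorb the constant e * C. *)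
have [d2 d20 Cd2] : exists2 d, 0 < d &
    forall t, 0 < t < d -> (e * C)^-1 * t `^ (a / 2) < 1.
  by apply: powR_lt_inv_near0; [lra|rewrite invr_gt0 mulr_gt0].
have c1 : 1 < 1 + a / 2 by lra.
have m0 : 0 < Num.min (t0 / 2) d2 by rewrite lt_min d20 andbT; lra.
have [t /andP[t_gt0 tlt] gt] := gsmall _ _ c1 m0.
move: tlt; rewrite lt_min => /andP[t20 t22].
have td : 0 < t < d by apply/andP; split; lra.
have td2 : 0 < t < d2 by apply/andP; split; lra.
have tt0 : 0 < t <= t0 by apply/andP; split; lra.
have tt : 2 * t <= t0 by lra.
have := SC _ tt0; have := Cd2 _ td2; have := Sg _ td.
have := Sgap t t_gt0 tt.
move: gt.
have tN0 : t != 0 by rewrite gt_eqF.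
have -> : - (1 + a / 2) = - 1 + - (a / 2) by lra.
have -> : t `^ a = t `^ (a / 2 + a / 2) by congr (_ `^ _); lra.
rewrite !powRD ?tN0 ?implybT// powR_inv1 ?(ltW t_gt0)// powRN lerN2.
have : 0 < t `^ (a / 2) by rewrite powR_gt0.
set p := t `^ (a / 2) => p0 H1 H2 H3 H4 H5.
move: H1; rewrite -invfM -div1r ltr_pdivlMr ?mulr_gt0// => H1.
move: H4; rewrite (ltr_pdivrMl _ _ (mulr_gt0 e0 C0)) mulr1 => H4.
have H6 : e * S t * p < 1.
  apply: le_lt_trans H1; rewrite mulrA ler_wpM2r ?(ltW p0)//.
  lra.
have H7 : e * C <= e * S t * p * p by rewrite -!mulrA ler_pM2l.
have : e * S t * p * p < 1 * p by rewrite ltr_pM2r.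
lra.
Qed.

Lemma eccentric_sequence {F : R -> \bar R} {S d} : 0 < d ->
  (forall t, 0 < t < d -> F t = (S t)%:E) ->
  (forall t, 0 < t < d -> 0 < S t) ->
  (forall e, 0 < e -> exists2 t, 0 < t < e & `|S (2 * t) / S t - 1| < e) ->
  exists t : R^nat, [/\ forall j, 0 < t j, t @ \oo --> 0 &
    (fun j => F (2 * t j)%R / F (t j))%E @ \oo --> 1%E].
Proof.
move=> d0 FS S0 Se.
have H j : exists t, [/\ 0 < t < d / 2, t < j.+1%:R^-1 &
    `|S (2 * t) / S t - 1| < j.+1%:R^-1].
  have [|t] := Se (Num.min (d / 2) j.+1%:R^-1);
    rewrite ?lt_min ?divr_gt0 ?invr_gt0 ?ltr0n//.
  by move=> /and3P[t0 td tj] /andP[_ ?]; exists t; split => //; rewrite t0.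
have [u uP] := choice H; exists u; split.
- by move=> j; have [/andP[]] := uP j.
- apply/cvgrPdist_lt => e e0; near=> j; rewrite sub0r normrN.
  have [/andP[u0 _] uj _] := uP j; rewrite gtr0_norm//.
  by apply: lt_trans uj _; near: j; exact: near_infty_natSinv_lt (PosNum e0).
- have -> : (fun j => F (2 * u j)%R / F (u j))%E =
      (fun j => (S (2 * u j) / S (u j))%:E).
    apply/funext => j; have [/andP[u0 ud] _ _] := uP j.
    have Su : 0 < S (u j) by apply: S0; apply/andP; split; lra.
    rewrite !FS; [|by apply/andP; split; lra..].
    by rewrite inver gt_eqF// EFinM.
  apply: cvg_EFin; first by near=> j.
  apply/cvgrPdist_lt => e e0; near=> j; rewrite distrC.
  have [_ _ uj] := uP j; apply: lt_trans uj _.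
  by near: j; exact: near_infty_natSinv_lt (PosNum e0).
Unshelve. all: by end_near. Qed.

End Doubling.

(** * The order at 0 as a comparison with powers *)

Section Order.
Context {R : realType}.
Implicit Types (f : R -> \bar R) (c d t : R) (x : \bar R).
Local Open Scope ereal_scope.

Definition order0 f : \bar R :=
  limf_einf (fun t => lne (f t) / (ln (1 / t))%:E) 0^'+.

Lemma ln_inv_gt0 {t} : (0 < t < 1)%R -> (0 < ln (1 / t))%R.
Proof. by move=> /andP[t0 t1]; rewrite ln_gt0// div1r invf_gt1. Qed.

Lemma mul_ln_inv {c t} : (0 < t)%R -> (c * ln (1 / t) = ln (t `^ (- c)))%R.
Proof. by move=> t0; rewrite ln_powR div1r lnV ?posrE//; lra. Qed.

(** No sign or finiteness condition on x: if x <= 0 or x is infinite, both sides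
    have the same truth value, thanks to the values of lne there. *)
Lemma lt_log_ratio {c t x} : (0 < t < 1)%R ->
  (c%:E < lne x / (ln (1 / t))%:E) = ((t `^ (- c))%:E < x).
Proof.
move=> /[dup] /andP[t0 t1] t01; have L0 := ln_inv_gt0 t01.
rewrite inver (gt_eqF L0) lte_pdivlMr// -EFinM.
have p0 : (0 < t `^ (- c))%R by rewrite powR_gt0.
case: x => [r| |] /=; rewrite ?ltry//.
case: ifPn => [r0|]; last first.
  by rewrite -ltNge => r0; rewrite !lte_fin mul_ln_inv// ltr_ln.
by rewrite ltNge leNye lte_fin ltNge (le_trans r0 (ltW p0)).
Qed.

Lemma log_ratio_lt {c t x} : (0 < t < 1)%R ->
  (lne x / (ln (1 / t))%:E < c%:E) = (x < (t `^ (- c))%:E).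
Proof.
move=> /[dup] /andP[t0 t1] t01; have L0 := ln_inv_gt0 t01.
rewrite inver (gt_eqF L0) lte_pdivrMr// -EFinM.
have p0 : (0 < t `^ (- c))%R by rewrite powR_gt0.
case: x => [r| |] /=; rewrite ?ltNyr//.
case: ifPn => [r0|]; first by rewrite ltNyr lte_fin (le_lt_trans r0 p0).
by rewrite -ltNge => r0; rewrite !lte_fin mul_ln_inv// ltr_ln.
Qed.

Lemma order_gt {f c l} : (c < l)%R ->
  order0 f = l%:E ->
  \forall t \near 0^'+, (t `^ (- c))%:E < f t.
Proof.
move=> cl; rewrite /order0 limf_einfE => fl.
have : c%:E < l%:E by rewrite lte_fin.
rewrite -fl => /ereal_sup_gt[_ [V V0 <-] cV].
near=> t.
rewrite -lt_log_ratio; last first.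
  by apply/andP; split; near: t; [exact: nbhs_right_gt|exact: nbhs_right_lt].
apply: (lt_le_trans cV); apply: ereal_inf_lbound; exists t => //.
by near: t.
Unshelve. all: by end_near. Qed.

Lemma order_lt {f c d l} : (l < c)%R -> (0 < d)%R ->
  order0 f = l%:E ->
  exists2 t, (0 < t < d)%R & f t < (t `^ (- c))%:E.
Proof.
move=> lc d0; rewrite /order0 limf_einfE => fl.
pose V : set R := [set t | (0 < t < Num.min d 1)%R].
have V0 : 0^'+ V.
  by apply/near_right0P; exists (Num.min d 1%R) => //; rewrite lt_min d0 ltr01.
have : ereal_inf [set lne (f t) / (ln (1 / t))%:E | t in V] < c%:E.
  apply: (@le_lt_trans _ _ l%:E); last by rewrite lte_fin.
  by rewrite -fl; apply: ereal_sup_ubound; exists V.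
move=> /ereal_inf_lt[_ [t /andP[t0 +] <-]]; rewrite lt_min => /andP[td t1].
rewrite log_ratio_lt ?t0// => ft.
by exists t => //; rewrite t0.
Qed.

End Order.

(** * Integrals of nonincreasing functions *)

Section Monotone.
Context {R : realType}.
Variable f : R -> \bar R.
Hypothesis f_ge0 : forall t, (0 <= f t)%E.
Hypothesis f_dec : forall s t, s <= t -> (f t <= f s)%E.
Local Notation mu := (@lebesgue_measure R).

Lemma measurable_nonincreasing (D : set R) : measurable D -> measurable_fun D f.
Proof.
move=> mD.
apply: (measurability (@ErealGenCInfty.G R)) => [|/= _ [_] [r] -> <-].
  exact: ErealGenCInfty.measurableE.
apply: measurableI => //; apply: is_interval_measurable => s t /=.
rewrite !in_itv/= !andbT => fs ft u /andP[su ut].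
by rewrite in_itv/= andbT (le_trans ft)// f_dec.
Qed.

Lemma integral_ge_last (s t : R) : s <= t ->
  ((t - s)%:E * f t <= \int[mu]_(x in `]s, t[) f x)%E.
Proof.
move=> st.
have -> : ((t - s)%:E * f t = \int[mu]_(x in `]s, t[) cst (f t) x)%E.
  rewrite integral_cst// [X in (f t * X)%E]lebesgue_measure_itv/= lte_fin muleC.
  move: st; rewrite le_eqVlt => /predU1P[->|->]; last by rewrite EFinB.
  by rewrite ltxx subrr.
apply: ge0_le_integral => // [x _ /=||]; first exact: f_ge0.
- exact: measurable_nonincreasing.
- by move=> x /=; rewrite in_itv/= => /andP[_ /ltW]; exact: f_dec.
Qed.

Lemma integral_le_first (s t : R) (b : bool) : s <= t ->
  (\int[mu]_(x in [set` Interval (BRight s) (BSide b t)]) f x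
    <= (t - s)%:E * f s)%E.
Proof.
move=> st.
have -> : ((t - s)%:E * f s =
    \int[mu]_(x in [set` Interval (BRight s) (BSide b t)]) cst (f s) x)%E.
  rewrite integral_cst// [X in (f s * X)%E]lebesgue_measure_itv/= lte_fin muleC.
  move: st; rewrite le_eqVlt => /predU1P[->|->]; last by rewrite EFinB.
  by rewrite ltxx subrr.
apply: ge0_le_integral => //.
- exact: measurable_nonincreasing.
- move=> x /= /andP[sx _]; apply: f_dec.
  by rewrite bnd_simp in sx; exact: ltW.
Qed.

(** An infinite value at some t > 0 would propagate to ]0, t[ by monotonicity and
    make the order infinite. *)
Lemma fin_num_of_order :
  order0 f = 1%E ->
  forall t, 0 < t -> f t \is a fin_num.
Proof.
move=> ord t t0; have [|s /andP[s0 st] fs] := order_lt _ t0 ord (c := 2).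
  by rewrite ltr1n.
rewrite ge0_fin_numE//; apply: le_lt_trans (f_dec _ _ (ltW st)) _.
by apply: lt_le_trans fs _; exact: leey.
Qed.

Lemma gt0_of_order : order0 f = 1%E ->
  exists2 d, 0 < d & forall t, 0 < t < d -> (0 < f t)%E.
Proof.
move=> ord; apply/near_right0P; apply: filterS (order_gt (@ltr01 R) ord) => t.
by apply: le_lt_trans; rewrite lee_fin powR_ge0.
Qed.

Lemma eccentric_head_integral :
  order0 f = 1%E ->
  mu.-integrable `]0, 1[ f ->
  exists t : R^nat, [/\ forall j, 0 < t j, t @ \oo --> 0 &
    (fun j => \int[mu]_(s in `]0%R, (2 * t j)%R[) f s /
       \int[mu]_(s in `]0%R, t j[) f s)%E @ \oo --> 1%E].
Proof.
move=> ord intf.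
have ffin := fin_num_of_order ord.
pose F (t : R) := (\int[mu]_(s in `]0%R, t[) f s)%E.
have [d d0 fd] := gt0_of_order ord.
pose m := Num.min d 1.
have m0 : 0 < m by rewrite lt_min d0 ltr01.
have F_mono s t : s <= t -> (F s <= F t)%E.
  move=> st; apply: ge0_subset_integral => //.
    exact: measurable_nonincreasing.
  by apply: subset_itvl; rewrite bnd_simp.
have F_fin t : 0 < t < m -> F t \is a fin_num.
  move=> /andP[t0]; rewrite lt_min => /andP[_ /ltW t1].
  rewrite ge0_fin_numE ?integral_ge0//.
  apply: le_lt_trans (F_mono _ _ t1) _.
  case/integrableP: intf => _; under eq_integral do rewrite gee0_abs//.
  by [].
have F_ge t : 0 < t -> (t%:E * f t <= F t)%E.
  by move=> t0; rewrite -[X in X%:E]subr0; apply: integral_ge_last; exact: ltW.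
have F_gt0 t : 0 < t < m -> (0 < F t)%E.
  move=> /andP[t0]; rewrite lt_min => /andP[td _].
  by apply: lt_le_trans (F_ge t t0); rewrite mule_gt0 ?lte_fin// fd// t0.
apply: (@eccentric_sequence R F (fine \o F) m m0) => [t tm|t tm|].
- by rewrite /= fineK// F_fin.
- by rewrite /= -lte_fin fineK ?F_fin// F_gt0.
apply: (@increasing_doubling _ _ (fine \o f) m m0)
  => [t tm|s t s0 st tm|t tm|c c1].
- by rewrite /= -lte_fin fineK ?F_fin// F_gt0.
- rewrite /= fine_le ?F_fin ?F_mono//.
    by rewrite s0 (le_lt_trans st).
  by rewrite (lt_le_trans s0).
- case/andP: (tm) => t0 _.
  by rewrite /= -lee_fin EFinM !fineK ?F_fin ?ffin// F_ge.
- apply: filterS2 (nbhs_right_gt 0) (order_gt c1 ord) => t t0.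
  by rewrite /= -lte_fin fineK// ffin.
Qed.

Lemma eccentric_tail_integral :
  order0 f = 1%E ->
  exists t : R^nat, [/\ forall j, 0 < t j, t @ \oo --> 0 &
    (fun j => \int[mu]_(s in `](2 * t j)%R, 1%R[) f s /
       \int[mu]_(s in `]t j, 1%R[) f s)%E @ \oo --> 1%E].
Proof.
move=> ord.
have ffin := fin_num_of_order ord.
pose F (t : R) := (\int[mu]_(s in `]t, 1%R[) f s)%E.
have [d d0 fd] := gt0_of_order ord.
(* Halved so that 2 * t < Num.min d 1 for all t < m. *)
pose m := Num.min d 1 / 2.
have m0 : 0 < m by rewrite divr_gt0// lt_min d0 ltr01.
have md : m * 2 <= d by rewrite /m divfK// ge_min lexx.
have m1 : m * 2 <= 1 by rewrite /m divfK// ge_min lexx orbT.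
have F_mono s t : s <= t -> (F t <= F s)%E.
  move=> st; apply: ge0_subset_integral => //.
    exact: measurable_nonincreasing.
  by apply: subset_itvr; rewrite bnd_simp.
have F_fin t : 0 < t < 1 -> F t \is a fin_num.
  move=> /andP[t0 t1]; rewrite ge0_fin_numE ?integral_ge0//.
  apply: le_lt_trans (integral_le_first _ _ true (ltW t1)) _.
  by rewrite -(fineK (ffin _ t0)) -EFinM ltry.
have F_gt0 t : 0 < t < m -> (0 < F t)%E.
  move=> /andP[t0 tm].
  have tt : t <= 2 * t by lra.
  apply: (@lt_le_trans _ _ ((2 * t - t)%:E * f (2 * t)%R)%E).
    rewrite mule_gt0 ?lte_fin//; first by lra.
    by apply: fd; apply/andP; split; lra.
  apply: le_trans (integral_ge_last _ _ tt) _.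
  apply: ge0_subset_integral => //; first exact: measurable_nonincreasing.
  by apply: subset_itvl; rewrite bnd_simp; lra.
have F_split t : 0 < t < m -> (F t <= t%:E * f t + F (2 * t)%R)%E.
  move=> /andP[t0 tm].
  have tt : t <= 2 * t by lra.
  have -> : F t = (\int[mu]_(s in `]t, (2 * t)%R]) f s + F (2 * t)%R)%E.
    rewrite /F -ge0_integral_setU//.
    - by rewrite -itv_bndbnd_setU// bnd_simp; lra.
    - apply: measurable_nonincreasing; exact: measurableU.
    - rewrite disj_set2E; apply/eqP/seteqP; split => // x [] /=.
      by rewrite !in_itv/= => /andP[_ x2t] /andP[/lt_le_trans/(_ x2t)]; rewrite ltxx.
  apply: leeD => //; apply: le_trans (integral_le_first _ _ false tt) _.
  by rewrite (_ : 2 * t - t = t)//; lra.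
have mI t : 0 < t < m -> 0 < t < 1 by move=> /andP[? ?]; apply/andP; split; lra.
have mI2 t : 0 < t < m -> 0 < 2 * t < 1.
  by move=> /andP[? ?]; apply/andP; split; lra.
apply: (@eccentric_sequence R F (fine \o F) m m0) => [t tm|t tm|].
- by rewrite /= fineK// F_fin// mI.
- by rewrite /= -lte_fin fineK ?F_fin ?mI// F_gt0.
apply: (@decreasing_doubling _ _ (fine \o f) m m0)
  => [t tm|s t s0 st tm|t tm|c e c1 e0].
- by rewrite /= -lte_fin fineK ?F_fin ?mI// F_gt0.
- rewrite /= fine_le ?F_fin ?F_mono// mI//.
    by rewrite (lt_le_trans s0).
  by rewrite s0 (le_lt_trans st).
- case/andP: (tm) => t0 _.
  rewrite /= lerBlDr -lee_fin EFinD EFinM !fineK ?F_fin ?ffin ?mI2// ?mI//.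
  exact: F_split.
- have [t te ft] := order_lt c1 e0 ord; exists t => //.
  by case/andP: te => t0 _; rewrite /= -lte_fin fineK// ffin.
Qed.

End Monotone.

(** * The rearrangement of an operator *)

Section Rearrangement.
Context {R : realType} {H : completeNormedModType R[i]}.
Variables (dot : {dot H for Num.conj}) (tr : (H -> H) -> \bar R).
Variable a : set (H * H).

Lemma rearrangement_ge0 t : (0 <= rearrangement dot tr a t)%E.
Proof. by apply: le_ereal_inf_tmp => _ [s [s0 _] <-]; rewrite lee_fin. Qed.

Lemma rearrangement_nonincreasing s t : s <= t ->
  (rearrangement dot tr a t <= rearrangement dot tr a s)%E.
Proof.
move=> st; apply: ereal_inf_le_tmp => _ [u [u0 us] <-]; exists u => //; split=> //.
by apply: le_trans us _; rewrite lee_fin.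
Qed.

End Rearrangement.

Theorem theorem1p7 (R : realType) (H : completeNormedModType R[i])
    (dot : {dot H for Num.conj}) (M : set (H -> H))
    (tr : (H -> H) -> \bar R) (a : set (H * H)) :
  is_hilbert dot ->
  von_neumann_algebra dot M ->
  nsf_trace dot M tr ->
  tr_measurable dot M tr a ->
  order_infinite0 dot tr a = 1%E ->
  eccentric0 dot tr a.
Proof.
move=> _ _ _ _ ord.
have f0 := rearrangement_ge0 dot tr a.
have fdec := rearrangement_nonincreasing dot tr a.
rewrite /eccentric0 /S0 /=; case: asboolP => [intf|_].
  exact: eccentric_head_integral.
exact: eccentric_tail_integral.
Qed.
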